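(* For every pair of integers $t,d\geq 1$ and every integer $k\geq (t+4)^{d}-(t+3)^{d}+(t+2)^{d}-2^{d}+d(t+2)+3$, there exists a measurable $k$-coloring $c:\mathbb{R}^d\to\{1,\dots,k\}$ such that no cube in $\mathbb{R}^d$ has a fair splitting of size at most $t$.
   Context: A $k$-coloring $c:\mathbb{R}^d\to\{1,\dots,k\}$ is measurable if each color class $c^{-1}(i)$ is Lebesgue measurable. A cube in $\mathbb{R}^d$ is a Cartesian product $[a_1,b_1]\times\cdots\times[a_d,b_d]$ of $d$ non-degenerate intervals of the same length. A splitting of a cube is given by a finite family of axis-aligned hyperplanes (hyperplanes of the form $\{x: x_i = s\}$ with $a_i<s<b_i$); these hyperplanes cut the cube into a family of cuboids (axis-parallel boxes). The size of the splitting is the maximum, over the $d$ coordinate directions $i$, of the number of hyperplanes of the family orthogonal to the $i$-th axis. A splitting of a cube $Q$ is fair (for the coloring $c$) if the resulting family of cuboids can be partitioned into two subfamilies $F_1,F_2$ such that for every color $j$, the union of the cuboids in $F_1$ and the union of the cuboids in $F_2$ each contain exactly half of the $d$-dimensional Lebesgue measure of $c^{-1}(j)\cap Q$. *)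

(* Defs.v *)
From HB Require Import structures.
From mathcomp Require Import all_boot all_order all_algebra.
From mathcomp Require Import all_classical all_reals.
From mathcomp Require Import ereal sequences.
Set Implicit Arguments. Unset Strict Implicit. Unset Printing Implicit Defensive.
Import Order.TTheory GRing.Theory Num.Theory.
Local Open Scope classical_set_scope.
Local Open Scope ring_scope.

Definition pt (R : realType) (d : nat) := 'I_d -> R.

Definition box (R : realType) (d : nat) (a b : pt R d) : set (pt R d) :=
  [set x | forall i, a i <= x i <= b i].

(* Elementary volume of a box (for a <= b coordinatewise). *)
Definition box_vol (R : realType) (d : nat) (a b : pt R d) : R :=
  \prod_(i < d) (b i - a i).

Definition leb_outer (R : realType) (d : nat) (A : set (pt R d)) : \bar R :=
  ereal_inf [set S : \bar R | exists a b : nat -> pt R d,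
     [/\ (forall n i, a n i <= b n i),
         A `<=` \bigcup_n box (a n) (b n) &
         S = (\sum_(0 <= n <oo) (box_vol (a n) (b n))%:E)%E]].

(* Lebesgue measurability in R^d (Caratheodory criterion w.r.t. the
   Lebesgue outer measure). On such sets leb_outer is Lebesgue measure. *)
Definition leb_measurable (R : realType) (d : nat) (A : set (pt R d)) : Prop :=
  forall E : set (pt R d),
    leb_outer E = (leb_outer (E `&` A) + leb_outer (E `&` ~` A))%E.

Definition measurable_coloring (R : realType) (d k : nat)
  (c : pt R d -> 'I_k) : Prop :=
  forall j : 'I_k, leb_measurable (c @^-1` [set j]).

(* The cube with lower corner a and side length s (s > 0 required
   separately): prod_i [a i, a i + s]. *)
Definition cube (R : realType) (d : nat) (a : pt R d) (s : R) : set (pt R d) :=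
  box a (fun i => a i + s).

(* A splitting of the cube (a, s): for each direction i, a duplicate-free
   list H i of positions h of the hyperplanes {x | x i = h}, with
   a i < h < a i + s. *)
Definition is_splitting (R : realType) (d : nat) (a : pt R d) (s : R)
  (H : 'I_d -> seq R) : Prop :=
  forall i, uniq (H i) /\ (forall h, h \in H i -> a i < h < a i + s).

Definition splitting_size (d : nat) (R : Type) (H : 'I_d -> seq R) : nat :=
  \max_(i < d) size (H i).

Definition breakpoints (R : realType) (d : nat) (a : pt R d) (s : R)
  (H : 'I_d -> seq R) (i : 'I_d) : seq R :=
  a i :: rcons (sort <=%R (H i)) (a i + s).

(* Cuboids of the splitting are indexed by m : 'I_d -> nat with
   m i <= size (H i); the cuboid m is the product of the intervals between
   the (m i)-th and (m i + 1)-th breakpoints. *)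
Definition cuboid_index (R : realType) (d : nat) (H : 'I_d -> seq R)
  (m : 'I_d -> nat) : Prop := forall i, (m i <= size (H i))%N.

Definition cuboid (R : realType) (d : nat) (a : pt R d) (s : R)
  (H : 'I_d -> seq R) (m : 'I_d -> nat) : set (pt R d) :=
  box (fun i => nth 0 (breakpoints a s H i) (m i))
      (fun i => nth 0 (breakpoints a s H i) (m i).+1).

Definition cuboid_union (R : realType) (d : nat) (a : pt R d) (s : R)
  (H : 'I_d -> seq R) (F : set ('I_d -> nat)) : set (pt R d) :=
  [set x | exists m, [/\ cuboid_index H m, F m & cuboid a s H m x]].

(* The splitting H of the cube (a, s) is fair for c: the cuboids can be
   split into two subfamilies F1 = F and F2 = its complement (among the
   cuboids), each of whose unions contains exactly half of the measure of
   every color class inside the cube. *)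
Definition fair_splitting (R : realType) (d k : nat) (c : pt R d -> 'I_k)
  (a : pt R d) (s : R) (H : 'I_d -> seq R) : Prop :=
  exists F : set ('I_d -> nat),
    forall j : 'I_k,
      let C := c @^-1` [set j] in
      (2%:E * leb_outer (C `&` cuboid_union a s H F)
         = leb_outer (C `&` cube a s))%E /\
      (2%:E * leb_outer (C `&` cuboid_union a s H (~` F))
         = leb_outer (C `&` cube a s))%E.

(* Main.v *)
Require Import Defs.
From HB Require Import structures.
From mathcomp Require Import all_boot all_order all_algebra.
From mathcomp Require Import all_classical all_reals.
From mathcomp Require Import ereal sequences.
From mathcomp Require Import esum numfun measure measurable_realfun.
From mathcomp Require Import lebesgue_measure lebesgue_integral.
From mathcomp Require Import zify ring lra.
Import Order.TTheory GRing.Theory Num.Theory.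
Local Open Scope classical_set_scope.
Local Open Scope ring_scope.

Set Implicit Arguments.
Unset Strict Implicit.
Unset Printing Implicit Defensive.

(** Let [P = d (t + 2)] be the number of hyperplanes bounding the cells of a
    splitting of size [t], padded to [t + 2] positions per axis. Inside a given
    small cube place [2 P + 1] tiny boxes, one per colour, whose projections to
    every axis are pairwise disjoint, so that the hyperplanes meet at most [P] of
    them. Repaint box [j] with colour [j] on a part of volume [w j] and with a
    spare colour, white, elsewhere. When the hyperplanes miss box [j], it lies in
    one cell, so the two sides of the splitting differ in colour [j] by
    [phi_j +- w j], where [phi_j] comes from the old colouring and is a Lipschitz
    function of the [P] positions. Since at least [P + 1] colours are missed, a
    pigeonhole count over [N ^ P] cells of positions and [N ^ (2 P + 1)] choices
    of [w] produces a [w] for which some colour is unbalanced by a fixed [rho > 0]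
    in every splitting of every box around the small cube. This survives later
    changes of total volume below [rho / 2], so treating a countable family of
    small cubes one after the other, with rapidly decreasing changes, converges
    to a colouring with no fair splitting. *)

(** * Lebesgue outer measure *)

Lemma box_vol_ge0 (R : realType) (d : nat) (a b : pt R d) :
  (forall i, a i <= b i) -> 0 <= box_vol a b.
Proof. by move=> ab; apply: prodr_ge0 => i _; rewrite subr_ge0. Qed.

Definition set_coord (R : realType) (d : nat) (x : pt R d) (i : 'I_d) (v : R) : pt R d :=
  fun j => if j == i then v else x j.

Lemma box_vol_set_coordr (R : realType) (d : nat) (a b : pt R d) (i : 'I_d) (v : R) :
  box_vol a (set_coord b i v) = (v - a i) * \prod_(j < d | j != i) (b j - a j).
Proof.
rewrite /box_vol (bigD1 i)//= {1}/set_coord eqxx; congr (_ * _).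
by apply: eq_bigr => j ji; rewrite /set_coord (negbTE ji).
Qed.

Lemma box_vol_set_coordl (R : realType) (d : nat) (a b : pt R d) (i : 'I_d) (v : R) :
  box_vol (set_coord a i v) b = (b i - v) * \prod_(j < d | j != i) (b j - a j).
Proof.
rewrite /box_vol (bigD1 i)//= {1}/set_coord eqxx; congr (_ * _).
by apply: eq_bigr => j ji; rewrite /set_coord (negbTE ji).
Qed.

Lemma nneseries_pair (R : realType) (g : nat -> nat -> \bar R)
    (f : nat -> nat * nat) : set_bij [set: nat] [set: nat * nat] f ->
  (forall i j, 0 <= g i j)%E ->
  (\sum_(k <oo) g (f k).1 (f k).2 = \sum_(i <oo) \sum_(j <oo) g i j)%E.
Proof.
move=> fbij g0; rewrite [RHS]nneseries_esumT; last first.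
  by move=> i; exact: nneseries_ge0.
under eq_esum do rewrite nneseries_esumT//.
rewrite esum_esum// nneseries_esumT//.
rewrite (_ : _ `*`` _ = [set: nat * nat]); last by apply/seteqP; split.
by rewrite (@reindex_esum R _ _ _ _ _ (fun k : nat * nat => g k.1 k.2) fbij).
Qed.

Section outer_measure.
Variables (R : realType) (d : nat).
Local Notation T := (pt R d.+1).
Local Notation mu := (@leb_outer R d.+1).

Lemma leb_outer_ge0 (A : set T) : (0 <= mu A)%E.
Proof.
apply: le_ereal_inf_tmp => _ [a [b [ab _ ->]]].
by apply: nneseries_ge0 => n _ _; rewrite lee_fin box_vol_ge0.
Qed.

Lemma leb_outer_le (A : set T) (a b : nat -> T) :
  (forall n i, a n i <= b n i) -> A `<=` \bigcup_n box (a n) (b n) ->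
  (mu A <= \sum_(n <oo) (box_vol (a n) (b n))%:E)%E.
Proof. by move=> ab cov; apply: ereal_inf_lbound; exists a, b. Qed.

Lemma le_leb_outer : {homo mu : A B / A `<=` B >-> (A <= B)%E}.
Proof.
move=> A B AB; apply: ereal_inf_le_tmp => _ [a [b [ab cov ->]]].
by exists a, b; split => //; exact: subset_trans cov.
Qed.

(** Positive dimension matters here: in dimension 0 the empty product would give every box volume
    1. *)
Lemma box_vol_degenerate (a : T) : box_vol a a = 0.
Proof. by rewrite /box_vol big_ord_recl subrr mul0r. Qed.

Lemma leb_outer_box_le (a b : T) : (forall i, a i <= b i) ->
  (mu (box a b) <= (box_vol a b)%:E)%E.
Proof.
move=> ab.
(* Covers are infinite sequences, so the box is followed by one-point boxes of volume 0. *)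
pose b' n := if n is 0%N then b else a.
apply: (@le_trans _ _ (\sum_(n <oo) (box_vol a (b' n))%:E)%E).
  apply: leb_outer_le => [[|n] i//|x xab]; by exists 0%N.
rewrite nneseries_recl//; last first.
  by move=> [|n] *; rewrite lee_fin box_vol_ge0.
rewrite eseries_cond eseries0 ?adde0// => -[|n] //= _ _.
by rewrite box_vol_degenerate.
Qed.

Lemma leb_outer0 : mu set0 = 0%E.
Proof.
apply/eqP; rewrite eq_le leb_outer_ge0 andbT.
rewrite -[leRHS]/(0%:E) -(box_vol_degenerate (fun=> 0)).
by apply: le_trans (leb_outer_box_le _); first exact: le_leb_outer.
Qed.

(** Cover each [F n] up to an error [e / 2 ^ (n + 1)] and merge the covers into one sequence through
    a bijection between [nat] and [nat * nat]. *)
Lemma leb_outer_sigma_subadditive : sigma_subadditive mu.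
Proof.
move=> F; have [[n Fn]|Ffin] := pselect (exists n, mu (F n) = +oo%E).
  rewrite (@nneseries_pinfty _ _ xpredT n) ?leey// => m _; exact: leb_outer_ge0.
apply/lee_addgt0Pr => _/posnumP[e].
have [ab abP] : {ab : nat -> (nat -> T) * (nat -> T) & forall n,
    [/\ forall m i, (ab n).1 m i <= (ab n).2 m i,
        F n `<=` \bigcup_m box ((ab n).1 m) ((ab n).2 m) &
        (\sum_(m <oo) (box_vol ((ab n).1 m) ((ab n).2 m))%:E
          <= mu (F n) + (e%:num / (2 ^ n.+1)%:R)%:E)%E]}.
  apply: (@choice _ _ (fun n ab =>
    [/\ forall m i, ab.1 m i <= ab.2 m i,
        F n `<=` \bigcup_m box (ab.1 m) (ab.2 m) &
        (\sum_(m <oo) (box_vol (ab.1 m) (ab.2 m))%:E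
          <= mu (F n) + (e%:num / (2 ^ n.+1)%:R)%:E)%E])) => n.
  have Fn_fin : mu (F n) \is a fin_num.
    rewrite ge0_fin_numE ?leb_outer_ge0// ltey; apply/eqP => Fn.
    by apply: Ffin; exists n.
  have en : 0 < e%:num / (2 ^ n.+1)%:R by [].
  have [_ [a [b [ab cov ->]]] /ltW le_ab] := lb_ereal_inf_adherent en Fn_fin.
  by exists (a, b).
have [f fbij] : exists f, set_bij [set: nat] [set: nat * nat] f.
  by apply/card_set_bijP; exact: card_esym card_nat2.
apply: le_trans (epsilon_trick xpredT _ (ltW (gt0 e))); last first.
  by move=> n; exact: leb_outer_ge0.
have vol0 i j : (0 <= (box_vol ((ab i).1 j) ((ab i).2 j))%:E)%E.
  by rewrite lee_fin; apply: box_vol_ge0; have [] := abP i.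
apply: (@le_trans _ _
    (\sum_(i <oo) \sum_(j <oo) (box_vol ((ab i).1 j) ((ab i).2 j))%:E)%E).
  rewrite -(nneseries_pair fbij)//.
  apply: (leb_outer_le (a := fun k => (ab (f k).1).1 (f k).2)
                       (b := fun k => (ab (f k).1).2 (f k).2)) => [n i|x [n _]].
    by have [] := abP (f n).1.
  have [_ cov _] := abP n => /cov[m _ xnm].
  have [_ _ surj] := fbij; have [k _ fk] := surj (n, m) I.
  by exists k => //; rewrite fk.
apply: lee_nneseries => [i _ _|i _]; first exact: nneseries_ge0.
by have [] := abP i.
Qed.

HB.instance Definition _ := isOuterMeasure.Build R T mu
  leb_outer0 leb_outer_ge0 le_leb_outer leb_outer_sigma_subadditive.

Lemma leb_measurable_halfspace (i : 'I_d.+1) (s : R) :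
  leb_measurable [set x : T | x i <= s].
Proof.
suff : mu.-caratheodory [set x : T | x i <= s] by [].
apply: le_caratheodory_measurable => X.
apply: le_ereal_inf_tmp => _ [a [b [ab cov ->]]].
(* The cutting height is clamped to the side of the box, so both pieces are genuine boxes, possibly
   flat, even when the hyperplane misses the box. *)
pose z n := Order.max (a n i) (Order.min (b n i) s).
have az n : a n i <= z n by rewrite /z le_max lexx.
have zb n : z n <= b n i by rewrite /z ge_max ab ge_min lexx.
pose b' n := set_coord (b n) i (z n); pose a' n := set_coord (a n) i (z n).
have ab' n j : a n j <= b' n j.
  by rewrite /b' /set_coord; case: eqP => [->|_]; rewrite ?az ?ab.
have a'b n j : a' n j <= b n j.
  by rewrite /a' /set_coord; case: eqP => [->|_]; rewrite ?zb ?ab.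
have -> : (\sum_(n <oo) (box_vol (a n) (b n))%:E =
    \sum_(n <oo) (box_vol (a n) (b' n))%:E + \sum_(n <oo) (box_vol (a' n) (b n))%:E)%E.
  rewrite -nneseriesD; last 2 first.
  - by move=> n _ _; rewrite lee_fin box_vol_ge0.
  - by move=> n _ _; rewrite lee_fin box_vol_ge0.
  apply: eq_eseriesr => n _; rewrite -EFinD; congr (_%:E).
  rewrite /b' /a' box_vol_set_coordr box_vol_set_coordl -mulrDl.
  by rewrite /box_vol (bigD1 i)//=; congr (_ * _); ring.
apply: leeD; apply: leb_outer_le => // x /= [Xx xs].
- have [n _ xn] := cov _ Xx; exists n => // j; have /andP[aj bj] := xn j.
  rewrite aj /b' /set_coord /=; case: eqP => [ji|//].
  by rewrite /z le_max le_min -ji bj ji xs orbT.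
- have [n _ xn] := cov _ Xx; exists n => // j; have /andP[aj bj] := xn j.
  rewrite bj andbT /a' /set_coord /=; case: eqP => [ji|//].
  have {}xs : s < x i by rewrite ltNge; apply/negP.
  by rewrite /z ge_max -ji aj ge_min ji (ltW xs) orbT.
Qed.

End outer_measure.

(** * Volume and measurability of boxes *)

Definition cons_pt (R : realType) (d : nat) (y : R) (x : pt R d) : pt R d.+1 :=
  fun i => oapp x y (unlift ord0 i).

Lemma cons_pt0 (R : realType) (d : nat) (y : R) (x : pt R d) :
  cons_pt y x ord0 = y.
Proof. by rewrite /cons_pt unlift_none. Qed.

Lemma cons_ptS (R : realType) (d : nat) (y : R) (x : pt R d) (i : 'I_d) :
  cons_pt y x (lift ord0 i) = x i.
Proof. by rewrite /cons_pt liftK. Qed.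

Lemma lebesgue_measure_cc (R : realType) (a b : R) : a <= b ->
  lebesgue_measure (`[a, b]%classic : set R) = (b - a)%:E.
Proof.
move=> ab; rewrite lebesgue_measure_itv /= lte_fin EFinB.
by case: ltP => // ba; rewrite -EFinB (_ : a = b) ?subrr//; apply/le_anti/andP.
Qed.

(* The weights [v] absorb the indicator functions of the first coordinate, over
   which the inequality for the slices is then integrated. *)
Lemma weighted_cover_volume (R : realType) (d : nat) (a b : nat -> pt R d)
    (v : nat -> R) (A B : pt R d) :
  (forall n, 0 <= v n) -> (forall n i, a n i <= b n i) ->
  (forall i, A i <= B i) ->
  (forall x, box A B x ->
    (1 <= \sum_(n <oo) (v n * \prod_(i < d) \1_(`[a n i, b n i]%classic) (x i))%:E)%E) ->
  ((box_vol A B)%:E <= \sum_(n <oo) (v n * box_vol (a n) (b n))%:E)%E.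
Proof.
elim: d a b v A B => [|d IH] a b v A B v0 ab AB cov.
  have /cov : box A B (fun=> 0) by case.
  under eq_eseriesr do rewrite big_ord0.
  rewrite /box_vol big_ord0 => /le_trans; apply.
  by under [leRHS]eq_eseriesr do rewrite big_ord0.
pose tl (x : pt R d.+1) : pt R d := fun i => x (lift ord0 i).
have volE x y : box_vol x y = (y ord0 - x ord0) * box_vol (tl x) (tl y).
  by rewrite /box_vol big_ord_recl.
pose I n := `[a n ord0, b n ord0]%classic : set R.
pose w n := v n * box_vol (tl (a n)) (tl (b n)).
have w0 n : 0 <= w n by rewrite mulr_ge0// box_vol_ge0// /tl.
(* For fixed first coordinate [y], the induction hypothesis applies to the slice with weights
   [v n * \1_(I n) y]. *)
have slice y : `[A ord0, B ord0]%classic y ->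
    ((box_vol (tl A) (tl B))%:E <= \sum_(n <oo) (w n)%:E * (\1_(I n) y)%:E)%E.
  move=> yAB.
  have := IH (fun n => tl (a n)) (fun n => tl (b n))
    (fun n => v n * \1_(I n) y) (tl A) (tl B).
  rewrite (_ : (\sum_(n <oo) (v n * \1_(I n) y * _)%:E)%E =
    (\sum_(n <oo) (w n)%:E * (\1_(I n) y)%:E)%E); last first.
    by apply: eq_eseriesr => n _; rewrite -EFinM /w; congr (_%:E); ring.
  apply => //.
  - by move=> n; rewrite mulr_ge0// indicE.
  - by move=> n i; rewrite /tl.
  - by move=> i; rewrite /tl.
  move=> x xAB.
  have /cov : box A B (cons_pt y x).
    move=> i; case: (unliftP ord0 i) => [j|] ->; rewrite ?cons_ptS ?cons_pt0.
      exact: xAB.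
    by move: yAB; rewrite /= in_itv.
  move=> /le_trans; apply; apply: lee_nneseries => [n _ _|n _].
    rewrite lee_fin mulr_ge0// prodr_ge0// => i _; by rewrite indicE.
  rewrite lee_fin big_ord_recl cons_pt0 mulrA.
  by under eq_bigr do rewrite cons_ptS.
have mI n : measurable (I n) by exact: measurable_itv.
have mwI n : measurable_fun `[A ord0, B ord0]%classic
    (fun y => (w n)%:E * (\1_(I n) y)%:E)%E.
  apply: measurable_funeM; apply/measurable_EFinP.
  exact: measurable_indic.
have wI0 n y : (0 <= (w n)%:E * (\1_(I n) y)%:E)%E.
  by rewrite mule_ge0// lee_fin// indicE.
rewrite volE mulrC EFinM -lebesgue_measure_cc//.
have mD : measurable (`[A ord0, B ord0]%classic : set R) by exact: measurable_itv.
rewrite -(integral_cst lebesgue_measure mD).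
apply: (@le_trans _ _ (\int[lebesgue_measure]_(y in `[A ord0, B ord0]%classic)
    \sum_(n <oo) (w n)%:E * (\1_(I n) y)%:E)%E).
  apply: ge0_le_integral => //.
  - by move=> y _; rewrite lee_fin box_vol_ge0// /tl.
  - exact: (ge0_emeasurable_sum (P := xpredT) (fun n y _ _ => wI0 n y)).
(* Sum and integral are exchanged; each term integrates to [w n] times the length of the part of
   [I n] inside the first side, at most [b n ord0 - a n ord0]. *)
rewrite integral_nneseries//.
apply: lee_nneseries => [n _ _|n _]; first exact: integral_ge0.
rewrite ge0_integralZl_EFin//; last first.
  by apply/measurable_EFinP; apply: measurable_indic; exact: mI.
rewrite integral_indic; [|exact: mD|exact: mI].
rewrite (_ : v n * _ = w n * (b n ord0 - a n ord0)); last first.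
  by rewrite volE /w; ring.
rewrite (EFinM (w n)); apply: lee_wpmul2l; first by rewrite lee_fin.
rewrite -lebesgue_measure_cc//; apply: le_measure; rewrite ?inE.
- by apply: measurableI; [exact: mI|exact: mD].
- exact: mI.
- exact: subIsetl.
Qed.

Section box_measure.
Variables (R : realType) (d : nat).
Local Notation T := (pt R d.+1).
Local Notation mu := (@leb_outer R d.+1).

(** The lower bound is [weighted_cover_volume] with unit weights: at each point of the box some
    covering box contributes a product of indicators equal to 1. *)
Lemma leb_outer_box (a b : T) : (forall i, a i <= b i) ->
  mu (box a b) = (box_vol a b)%:E.
Proof.
move=> ab; apply/eqP; rewrite eq_le leb_outer_box_le//=.
apply: le_ereal_inf_tmp => _ [a' [b' [ab' cov ->]]].
under eq_eseriesr do rewrite -[box_vol _ _]mul1r.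
apply: (weighted_cover_volume (v := fun=> 1)) => // x /cov[n _ xn].
have term0 m : (0 <= (1 * \prod_(i < d.+1) \1_(`[a' m i, b' m i]%classic) (x i) : R)%:E)%E.
  by rewrite lee_fin mul1r prodr_ge0// => i _; rewrite indicE.
rewrite (@nneseriesD1 _ _ n xpredT)//.
rewrite [X in (X + _)%E](_ : _ = 1%E); last first.
  rewrite mul1r big1// => i _; rewrite indicE mem_set//=.
  by rewrite in_itv; exact: xn.
by rewrite leeDl// nneseries_ge0.
Qed.

Local Notation M := (@leb_measurable R d.+1).

Lemma leb_measurableC (A : set T) : M A -> M (~` A).
Proof. exact: (@caratheodory_measurable_setC _ _ mu). Qed.

Lemma leb_measurableU (A B : set T) : M A -> M B -> M (A `|` B).
Proof. exact: (@caratheodory_measurable_setU _ _ mu). Qed.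

Lemma leb_measurableI (A B : set T) : M A -> M B -> M (A `&` B).
Proof. exact: (@caratheodory_measurable_setI _ _ mu). Qed.

Lemma leb_measurable0 : M set0.
Proof. exact: (@caratheodory_measurable_set0 _ _ mu). Qed.

Lemma leb_measurable_bigcup (A : nat -> set T) :
  (forall n, M (A n)) -> M (\bigcup_n A n).
Proof. exact: (@caratheodory_measurable_bigcup _ _ mu). Qed.

Lemma leb_measurable_fin_bigcup (I : finType) (A : I -> set T) :
  (forall i, M (A i)) -> M [set x | exists i, A i x].
Proof.
move=> mA; pose B (n : nat) : set T :=
  if (insub n : option 'I_#|I|) is Some i then A (enum_val i) else set0.
rewrite (_ : mkset _ = \bigcup_n B n); last first.
  apply/seteqP; split => x /=.
    move=> [i Aix]; exists (enum_rank i) => //.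
    by rewrite /B valK enum_rankK.
  by move=> [n _]; rewrite /B; case: insub => [i Aix|//]; exists (enum_val i).
apply: leb_measurable_bigcup => n; rewrite /B; case: insub => [i|]; first exact: mA.
exact: leb_measurable0.
Qed.

Lemma leb_measurable_fin_bigcap (I : finType) (A : I -> set T) :
  (forall i, M (A i)) -> M [set x | forall i, A i x].
Proof.
move=> mA; rewrite (_ : mkset _ = ~` [set x | exists i, (~` A i) x]); last first.
  apply/seteqP; split => x /=.
    by move=> Ax [i]; apply; exact: Ax.
  by move=> Ax i; apply: contrapT => Aix; apply: Ax; exists i.
by apply/leb_measurableC/leb_measurable_fin_bigcup => i; exact: leb_measurableC.
Qed.

Lemma leb_measurable_lt (i : 'I_d.+1) (s : R) : M [set x : T | x i < s].
Proof.
rewrite (_ : mkset _ = \bigcup_n [set x : T | x i <= s - n.+1%:R^-1]); last first.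
  apply/seteqP; split => x /=.
    move=> xs; have [n xn] := ltr_add_invr xs; exists n => //=.
    by rewrite lerBrDr ltW.
  by move=> [n _ /= xn]; rewrite (le_lt_trans xn)// ltrBlDr ltrDl.
by apply: leb_measurable_bigcup => n; exact: leb_measurable_halfspace.
Qed.

Lemma leb_measurable_box (a b : T) : M (box a b).
Proof.
apply: leb_measurable_fin_bigcap => i.
rewrite (_ : (fun x => _) =
  [set x : T | x i <= b i] `&` ~` [set x : T | x i < a i]); last first.
  apply/seteqP; split => x /=; first by move=> /andP[ax ->]; split => //; apply/negP; rewrite -leNgt.
  by move=> [-> /negP]; rewrite -leNgt => ->.
apply: leb_measurableI; first exact: leb_measurable_halfspace.
exact/leb_measurableC/leb_measurable_lt.
Qed.

Lemma leb_outerU (A B : set T) : M B -> A `&` B = set0 ->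
  (mu (A `|` B) = mu A + mu B)%E.
Proof.
move=> mB AB0; rewrite (mB (A `|` B)) addeC; congr (mu _ + mu _)%E.
  rewrite setIUl setICr setU0; apply/setIidPl => x Ax Bx.
  by have : (A `&` B) x by []; rewrite AB0.
by rewrite setIUl setIid; apply/setUidPr => x [].
Qed.

End box_measure.

(** * A pigeonhole principle *)

Lemma exists_subset_card (T : finType) (A : {set T}) (n : nat) :
  (n <= #|A|)%N -> exists2 J : {set T}, J \subset A & #|J| = n.
Proof.
move=> nA; exists [set j in take n (enum A)]%SET.
  by apply/fintype.subsetP => j; rewrite inE => /mem_take; rewrite mem_enum.
rewrite cardsE; have /card_uniqP -> : uniq (take n (enum A)).
  exact/take_uniq/enum_uniq.
by rewrite size_takel// -cardE.
Qed.

(** Union bound over pairs [(x, J)] with [J] a set of [P + 1] indices: at most [C ^ (P + 1) * N ^ P]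
    functions [w] hit [S x j] for every [j] in [J], and there are at most [#|X| * 2 ^ (2 P + 1)]
    pairs, so not all [N ^ (2 P + 1)] functions are bad. *)
Lemma exists_sparse_hits (X : finType) (P N C : nat)
    (S : X -> 'I_(P.*2.+1) -> {set 'I_N}) :
  (forall x j, (#|S x j| <= C)%N) ->
  (#|X| * 2 ^ P.*2.+1 * C ^ P.+1 < N ^ P.+1)%N ->
  exists w : {ffun 'I_(P.*2.+1) -> 'I_N},
    forall x, (#|[set j | w j \in S x j]%SET| <= P)%N.
Proof.
move=> SC big; apply: contrapT => nex.
pose fam (x : X) (J : {set 'I_(P.*2.+1)}) :=
  family (fun j => if j \in J then mem (S x j) else mem [set: 'I_N]%SET).
have bad (w : {ffun 'I_(P.*2.+1) -> 'I_N}) : exists x : X,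
    exists2 J : {set 'I_(P.*2.+1)}, #|J| == P.+1 & w \in fam x J.
  apply: contrapT => nbad; apply: nex; exists w => x.
  rewrite leqNgt; apply/negP => lt_hits.
  have [J JS cardJ] := exists_subset_card lt_hits.
  apply: nbad; exists x, J; first exact/eqP.
  apply/familyP => j; case: ifPn => jJ; last by rewrite !inE.
  by have := fintype.subsetP JS _ jJ; rewrite inE.
have famle x (J : {set 'I_(P.*2.+1)}) : #|J| == P.+1 -> (#|fam x J| <= C ^ P.+1 * N ^ P)%N.
  move=> /eqP cardJ; rewrite card_family foldrE big_map big_enum/=.
  rewrite (bigID (mem J))/= -cardJ leq_mul//.
    rewrite -prod_nat_const; apply: leq_prod => j jJ; rewrite jJ; exact: SC.
  have cardJC : #|~: J| = P by have := cardsC J; rewrite cardJ card_ord; lia.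
  rewrite -[in leqRHS]cardJC.
  rewrite -prod_nat_const [leqLHS](eq_bigl (fun j => j \in ~: J)); last by move=> j; rewrite finset.in_setC.
  by apply: leq_prod => j; rewrite finset.in_setC => /negbTE ->; rewrite cardsT card_ord.
suff : (N ^ P.*2.+1 <= #|X| * 2 ^ P.*2.+1 * (C ^ P.+1 * N ^ P))%N.
  have -> : (N ^ P.*2.+1 = N ^ P.+1 * N ^ P)%N by rewrite -expnD; congr expn; lia.
  rewrite mulnA leqNgt ltn_mul2r big andbT expn_gt0.
  by case: (N) big => //; rewrite exp0n.
have -> : (N ^ P.*2.+1 = \sum_(w : {ffun 'I_(P.*2.+1) -> 'I_N}) 1)%N.
  by rewrite sum1_card card_ffun !card_ord.
apply: (@leq_trans (\sum_(w : {ffun 'I_(P.*2.+1) -> 'I_N})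
   \sum_(p : X * {set 'I_(P.*2.+1)} | #|p.2| == P.+1) (w \in fam p.1 p.2))%N).
  apply: leq_sum => w _; have [x [J cardJ wJ]] := bad w.
  by rewrite (bigD1 (x, J))//= wJ.
rewrite exchange_big/=.
apply: (@leq_trans (\sum_(p : X * {set 'I_(P.*2.+1)}) C ^ P.+1 * N ^ P)%N).
  rewrite [leqRHS](bigID (fun p : X * {set 'I_(P.*2.+1)} => #|p.2| == P.+1))/= -[leqLHS]addn0 leq_add//.
  apply: leq_sum => -[x J]/= cardJ.
  by apply: leq_trans (famle x J cardJ); rewrite -sum1_card [leqRHS]big_mkcond.
rewrite sum_nat_const card_prod (_ : #|{set 'I_(P.*2.+1)}| = 2 ^ P.*2.+1)%N//.
by rewrite -[LHS]cardsT -powersetT card_powerset cardsT card_ord.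
Qed.

(** The values [(i + 1) s] lie in an open interval of length [2 B <= C s]; counted from the smallest
    admissible index, all indices fall in a window of length [C]. *)
Lemma card_close_indices (R : realType) (N C : nat) (z B s : R) :
  0 < s -> 2 * B <= C%:R * s ->
  (#|[set i : 'I_N | (`|z - i.+1%:R * s| < B)%R]%SET| <= C)%N.
Proof.
move=> s0 BC; set A := [set i : 'I_N | _]%SET.
have [->|/set0Pn[i0 i0A]] := eqVneq A finset.set0; first by rewrite cards0.
have [i iA imin] : exists2 i, i \in A & forall j, j \in A -> (i <= j)%N.
  by case: (arg_minnP (fun i : 'I_N => i) i0A) => i iA imin; exists i.
have -> : #|A| = size [seq val j | j <- enum A] by rewrite size_map -cardE.
rewrite -[leqRHS](size_iota i); apply: uniq_leq_size.
  by rewrite map_inj_uniq ?enum_uniq//; exact: val_inj.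
move=> _ /mapP[j + ->]; rewrite mem_enum => jA; rewrite mem_iota imin//=.
move: iA jA; rewrite !inE => iA jA.
rewrite -(ltr_nat R) natrD -(ltr_pM2r s0).
move: iA jA; rewrite !ltr_norml -!natr1 => /andP[iA1 iA2] /andP[jA1 jA2].
nra.
Qed.

(** * Imbalance of a splitting *)

(** Positions [y i 0, ..., y i (t + 1)] include the outer faces. The number of cells per axis is
    fixed, so that all splittings of size at most [t] share one finite type of families. *)
Definition cell_union (R : realType) (d t : nat) (y : 'I_d -> nat -> R)
    (F : {set {ffun 'I_d -> 'I_t.+1}}) : set (pt R d) :=
  [set x | exists2 m : {ffun 'I_d -> 'I_t.+1}, m \in F &
    forall i, y i (m i) <= x i <= y i (m i).+1].

(** [fine] sends an infinite measure to 0, hence the boundedness hypotheses in the estimates on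
    [vol]. *)
Definition vol (R : realType) (d : nat) (A : set (pt R d)) : R :=
  fine (leb_outer A).

Definition imbalance (R : realType) (d t : nat) (A : set (pt R d))
    (y : 'I_d -> nat -> R) (F : {set {ffun 'I_d -> 'I_t.+1}}) : R :=
  vol (A `&` cell_union y F) - vol (A `&` cell_union y (~: F)).

Section volume.
Variables (R : realType) (d : nat).
Local Notation T := (pt R d.+1).
Local Notation mu := (@leb_outer R d.+1).

Definition bounded_by (M : R) (A : set T) := A `<=` box (fun=> - M) (fun=> M).

Lemma bounded_by_fin_num (M : R) (A : set T) : 0 <= M -> bounded_by M A ->
  mu A \is a fin_num.
Proof.
move=> M0 AM; rewrite ge0_fin_numE ?leb_outer_ge0//.
apply: le_lt_trans (le_leb_outer AM) _.
rewrite leb_outer_box ?ltry// => i; lra.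
Qed.

Lemma leb_outer_fin_bigcup (I : finType) (A : I -> set T) :
  (mu [set x | exists i, A i x] <= \sum_(i : I) mu (A i))%E.
Proof.
have seqU (s : seq I) :
    (mu [set x | exists2 i, i \in s & A i x] <= \sum_(i <- s) mu (A i))%E.
  elim: s => [|j s IH].
    rewrite big_nil (_ : mkset _ = set0) ?leb_outer0//.
    by apply/seteqP; split => x // -[].
  rewrite big_cons; apply: le_trans (leeD (lexx _) IH).
  apply: le_trans (outer_measureU2 mu _ _); apply: le_leb_outer => x /= [i].
  by rewrite inE => /orP[/eqP-> Ax|si Ax]; [left|right; exists i].
apply: le_trans (seqU (index_enum I)).
by apply: le_leb_outer => x /= [i Ai]; exists i => //; rewrite mem_index_enum.
Qed.

Lemma vol_box (a b : T) : (forall i, a i <= b i) -> vol (box a b) = box_vol a b.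
Proof. by move=> ab; rewrite /vol leb_outer_box. Qed.

Lemma vol_le_bigcup (I : finType) (M : R) (A B : set T) (S : I -> set T) (e : R) :
  0 <= M -> bounded_by M A -> bounded_by M B ->
  A `<=` B `|` [set x | exists i, S i x] ->
  (forall i, mu (S i) <= e%:E)%E ->
  vol A <= vol B + #|I|%:R * e.
Proof.
move=> M0 AM BM AB Se; rewrite -lee_fin EFinD /vol.
rewrite !fineK ?(bounded_by_fin_num M0)//.
apply: le_trans (le_leb_outer AB) _.
apply: le_trans (outer_measureU2 mu _ _) _; apply: leeD => //.
apply: le_trans (leb_outer_fin_bigcup _) _.
apply: (@le_trans _ _ (\sum_(i : I) e%:E)%E); first exact: lee_sum.
by rewrite sumEFin sumr_const mulr_natl lexx.
Qed.

Lemma volU (M : R) (A B : set T) : 0 <= M -> bounded_by M A -> bounded_by M B ->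
  leb_measurable B -> A `&` B = set0 -> vol (A `|` B) = vol A + vol B.
Proof.
move=> M0 AM BM mB AB; rewrite /vol leb_outerU// fineD//;
  exact: bounded_by_fin_num M0 _.
Qed.

End volume.

Section splitting.
Variables (R : realType) (d t : nat).
Local Notation T := (pt R d.+1).
Local Notation mu := (@leb_outer R d.+1).
Implicit Types (y : 'I_d.+1 -> nat -> R) (F : {set {ffun 'I_d.+1 -> 'I_t.+1}}).

Lemma bounded_by_cell_union (M : R) y F (A : set T) :
  (forall i (l : 'I_t.+2), - M <= y i l <= M) ->
  bounded_by M (A `&` cell_union y F).
Proof.
move=> yM x [_ [m _ xm]] i; have /andP[x1 x2] := xm i.
have /andP[y1 _] := yM i (widen_ord (leqnSn _) (m i)).
have /andP[_ y2] := yM i (lift ord0 (m i)).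
by rewrite (le_trans y1 x1) (le_trans x2 y2).
Qed.

(* A point counted for [y] but not for [y'] lies in one of the slabs between
   corresponding hyperplanes. *)
Lemma vol_cell_union_close (M e : R) (lo y y' : 'I_d.+1 -> nat -> R) F (A : set T) :
  0 <= M -> 0 <= e ->
  (forall i (l : 'I_t.+2), - M <= y i l <= M) ->
  (forall i (l : 'I_t.+2), - M <= y' i l <= M) ->
  (forall i (l : 'I_t.+2), lo i l <= y i l <= lo i l + e) ->
  (forall i (l : 'I_t.+2), lo i l <= y' i l <= lo i l + e) ->
  vol (A `&` cell_union y F) <= vol (A `&` cell_union y' F) +
    (d.+1 * t.+2)%:R * (e * (2 * M) ^+ d).
Proof.
move=> M0 e0 yM y'M ylo y'lo.
have -> : (d.+1 * t.+2 = #|{: 'I_d.+1 * 'I_t.+2}|)%N by rewrite card_prod !card_ord.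
have MM : - M <= M by lra.
pose S (p : 'I_d.+1 * 'I_t.+2) : set T :=
  box (set_coord (fun=> - M) p.1 (lo p.1 p.2)) (set_coord (fun=> M) p.1 (lo p.1 p.2 + e)).
apply: (@vol_le_bigcup _ _ _ M _ _ S) => //; try exact: bounded_by_cell_union.
- move=> x [Ax /[dup] Ux [m mF xm]].
  have xM : box (fun=> - M) (fun=> M) x.
    exact: (@bounded_by_cell_union M y F A yM x (conj Ax Ux)).
  have slab i (l : 'I_t.+2) : lo i l <= x i <= lo i l + e ->
      exists p : 'I_d.+1 * 'I_t.+2, S p x.
    move=> xlo; exists (i, l) => j; rewrite /= /set_coord.
    by case: eqP => [->//|_]; exact: xM.
  have [|nslab] := pselect (exists p, S p x); [by right|left; split => //].
  exists m => // i; have /andP[x1 x2] := xm i.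
  have nslab' (l : 'I_t.+2) : ~ (lo i l <= x i <= lo i l + e).
    by move=> xlo; apply: nslab; exact: slab xlo.
  apply/andP; split; rewrite leNgt; apply/negP => xy.
    have /andP[l1 l2] := ylo i (widen_ord (leqnSn _) (m i)).
    have /andP[l1' l2'] := y'lo i (widen_ord (leqnSn _) (m i)).
    apply: (nslab' (widen_ord (leqnSn _) (m i))).
    by rewrite (le_trans l1 x1) (ltW (lt_le_trans xy l2')).
  have /andP[l1 l2] := ylo i (lift ord0 (m i)).
  have /andP[l1' l2'] := y'lo i (lift ord0 (m i)).
  apply: (nslab' (lift ord0 (m i))).
  by rewrite (le_trans l1' (ltW xy)) (le_trans x2 l2).
- move=> -[i l]; rewrite /S /=.
  have le_set_coord j : set_coord (fun=> - M) i (lo i l) j <= set_coord (fun=> M) i (lo i l + e) j.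
    by rewrite /set_coord; case: eqP => _ //; rewrite lerDl.
  apply: le_trans (leb_outer_box_le le_set_coord) _; rewrite lee_fin box_vol_set_coordr.
  rewrite {1}/set_coord eqxx (_ : lo i l + e - lo i l = e); last ring.
  rewrite ler_wpM2l// (eq_bigr (fun=> 2 * M)); last first.
    by move=> j /negbTE ji; rewrite /set_coord ji; ring.
  rewrite prodr_const (_ : #|_| = d)//.
  by have := cardC1 i; rewrite card_ord.
Qed.

Lemma imbalance_close (M e : R) (lo y y' : 'I_d.+1 -> nat -> R) F (A : set T) :
  0 <= M -> 0 <= e ->
  (forall i (l : 'I_t.+2), - M <= y i l <= M) ->
  (forall i (l : 'I_t.+2), - M <= y' i l <= M) ->
  (forall i (l : 'I_t.+2), lo i l <= y i l <= lo i l + e) ->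
  (forall i (l : 'I_t.+2), lo i l <= y' i l <= lo i l + e) ->
  `|imbalance A y F - imbalance A y' F| <=
    2 * (d.+1 * t.+2)%:R * (e * (2 * M) ^+ d).
Proof.
move=> M0 e0 yM y'M ylo y'lo; rewrite /imbalance.
have := vol_cell_union_close F A M0 e0 yM y'M ylo y'lo.
have := vol_cell_union_close F A M0 e0 y'M yM y'lo ylo.
have := vol_cell_union_close (~: F) A M0 e0 yM y'M ylo y'lo.
have := vol_cell_union_close (~: F) A M0 e0 y'M yM y'lo ylo.
by rewrite ler_norml; lra.
Qed.

Lemma exists_gap (y : nat -> R) (a b : R) (n : nat) :
  a <= b -> y 0%N < a -> b < y n.+1 ->
  (forall l, (l <= n.+1)%N -> y l < a \/ b < y l) ->
  exists2 m, (m <= n)%N & y m < a /\ b < y m.+1.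
Proof.
move=> ab; elim: n => [|n IH] y0 yn ycase; first by exists 0%N.
have [ya|yb] := ycase n.+1 (leqnSn _); first by exists n.+1.
have [|m mn ym] := IH y0 yb; last by exists m => //; rewrite (leq_trans mn).
by move=> l ln; apply: ycase; rewrite (leq_trans ln).
Qed.

(** On each axis the side of the box lies strictly between two consecutive positions. Strictness
    keeps the box off the faces shared by closed cells, so it meets no cell but [m]. *)
Lemma box_in_one_cell y (a b : T) :
  (forall i, a i <= b i) ->
  (forall i (l : nat), (l <= t)%N -> y i l <= y i l.+1) ->
  (forall i, y i 0%N <= a i) -> (forall i, b i <= y i t.+1) ->
  (forall i (l : 'I_t.+2), ~~ (a i <= y i l <= b i)) ->
  exists m : {ffun 'I_d.+1 -> 'I_t.+1}, forall F,
    (m \in F -> box a b `<=` cell_union y F) /\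
    (m \notin F -> box a b `&` cell_union y F = set0).
Proof.
move=> ab ymono ya yb unhit.
have ycase i l : (l <= t.+1)%N -> y i l < a i \/ b i < y i l.
  move=> lt; have := unhit i (Ordinal (lt : (l < t.+2)%N)).
  by rewrite negb_and -!ltNge => /orP[]; [left|right].
have [m mP] : exists m : {ffun 'I_d.+1 -> 'I_t.+1},
    forall i, y i (m i) < a i /\ b i < y i (m i).+1.
  have : forall i, exists m : 'I_t.+1, y i m < a i /\ b i < y i m.+1.
    move=> i; have [] := @exists_gap (y i) (a i) (b i) t (ab i).
    - by have [//|] := ycase i 0%N isT; rewrite ltNge (le_trans (ya i))//.
    - have [yt|//] := ycase i t.+1 (leqnn _).
      by have := lt_le_trans yt (ab i); rewrite ltNge yb.
    - exact: ycase.
    by move=> m mt ym; exists (Ordinal (mt : (m < t.+1)%N)).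
  by move=> /choice[m mP]; exists (finfun m) => i; rewrite ffunE.
have mono i l l' : (l <= l')%N -> (l' <= t.+1)%N -> y i l <= y i l'.
  elim: l' => [|l' IH]; first by rewrite leqn0 => /eqP ->.
  rewrite leq_eqVlt => /orP[/eqP ->//|ll'] lt.
  by apply: le_trans (ymono i l' _) => //; apply: IH => //; exact: ltnW.
exists m => F; split => [mF x xab|mF].
  exists m => // i; have [y1 y2] := mP i; have /andP[x1 x2] := xab i.
  by rewrite (le_trans (ltW y1) x1) (le_trans x2 (ltW y2)).
apply/seteqP; split => x // -[xab [m' m'F xm']].
suff mm' : m' = m by rewrite mm' (negbTE mF) in m'F.
apply/ffunP => i; apply/val_inj/eqP; rewrite eqn_leq.
have [y1 y2] := mP i; have /andP[x1 x2] := xab i; have /andP[x3 x4] := xm' i.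
apply/andP; split; rewrite leqNgt; apply/negP => lt.
  by have := mono i (m i).+1 (m' i) lt (ltnW (ltn_ord _)); lra.
by have := mono i (m' i).+1 (m i) lt (ltnW (ltn_ord _)); lra.
Qed.

End splitting.

(** * Recolouring inside a small cube *)

(** Each [hold j] is repainted [col j] on [sub j] and [white] elsewhere. As the holders are disjoint
    and [white] is no [col j], the class of [col j] loses all holders and regains exactly
    [sub j]. *)
Lemma recolor (R : realType) (d k : nat) (I : finType) (c : pt R d.+1 -> 'I_k)
    (col : I -> 'I_k) (white : 'I_k) (hold sub : I -> set (pt R d.+1)) :
  measurable_coloring c ->
  (forall j, leb_measurable (hold j)) -> (forall j, leb_measurable (sub j)) ->
  (forall j, sub j `<=` hold j) ->
  (forall i j x, hold i x -> hold j x -> i = j) ->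
  injective col -> (forall j, white != col j) ->
  exists c' : pt R d.+1 -> 'I_k,
    [/\ measurable_coloring c',
        forall x, ~ (exists j, hold j x) -> c' x = c x &
        forall j, c' @^-1` [set col j] =
          (c @^-1` [set col j] `&` ~` [set x | exists i, hold i x]) `|` sub j].
Proof.
move=> mc mhold msub subhold disj colI colW.
pose c' x := if [pick j | `[< hold j x >]] is Some j
  then if `[< sub j x >] then col j else white else c x.
have c'out x : ~ (exists j, hold j x) -> c' x = c x.
  rewrite /c'; case: pickP => [j /asboolP jx []|//]; by exists j.
have c'in j x : hold j x -> c' x = if `[< sub j x >] then col j else white.
  rewrite /c' => jx; case: pickP => [i /asboolP ix|/(_ j)/asboolP//].
  by rewrite (disj _ _ _ ix jx).
exists c'; split => //.
- move=> i.
  pose A j := (if col j == i then sub j else set0) `|`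
              (if white == i then hold j `&` ~` sub j else set0).
  rewrite (_ : _ @^-1` _ =
      (c @^-1` [set i] `&` ~` [set x | exists j, hold j x]) `|`
      [set x | exists j, A j x]); last first.
    apply/seteqP; split => x /=.
    + have [[j jx]|nx] := pselect (exists j, hold j x); last first.
        by rewrite c'out// => cx; left.
      rewrite (c'in j x jx); case: asboolP => sx ix; right; exists j; rewrite /A.
        by left; rewrite ix eqxx.
      by right; rewrite ix eqxx.
    + case=> [[cx nx]|[j]]; first by rewrite c'out.
      rewrite /A; case=> /=.
        case: eqP => [<- sx|//]; rewrite (c'in j x (subhold _ _ sx)).
        by rewrite asboolT.
      case: eqP => [<- [jx sx]|//]; rewrite (c'in j x jx).
      by rewrite asboolF.
  apply: leb_measurableU.
    by apply: leb_measurableI => //; apply/leb_measurableC/leb_measurable_fin_bigcup.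
  apply: leb_measurable_fin_bigcup => j; apply: leb_measurableU; case: ifP => _ //;
    try exact: leb_measurable0.
  by apply: leb_measurableI => //; exact: leb_measurableC.
- move=> j; apply/seteqP; split => x /=.
  + have [[i ix]|nx] := pselect (exists i, hold i x); last first.
      by rewrite c'out// => cx; left.
    rewrite (c'in i x ix); case: asboolP => sx; first by move=> /colI <-; right.
    by move=> /eqP; rewrite (negbTE (colW j)).
  + case=> [[cx nx]|sx]; first by rewrite c'out.
    by rewrite (c'in j x (subhold _ _ sx)) asboolT.
Qed.

(** Slots of length [u / 2] repeated with period [u] are disjoint. This separates the holders and
    shows that a hyperplane meets at most one of them. *)
Lemma slot_inj (R : realType) (u z w : R) (i j : nat) : 0 < u ->
  w + u * i%:R <= z <= w + u * i%:R + u / 2 ->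
  w + u * j%:R <= z <= w + u * j%:R + u / 2 -> i = j.
Proof.
move=> u0; wlog ij : i j / (i < j)%N.
  move=> H hi hj; have [/H|/H|//] := ltngtP i j; first exact.
  by move=> /(_ hj hi).
have : i.+1%:R <= j%:R :> R by rewrite ler_nat.
rewrite -natr1 => /(ler_wpM2l (ltW u0)); rewrite mulrDr mulr1 => ij' /andP[h1 h2] /andP[h3 h4].
by exfalso; lra.
Qed.

Lemma exists_grid_index (R : realType) (M : R) (N : nat) (z : R) :
  0 < M -> (0 < N)%N -> - M <= z < M ->
  exists g : 'I_N, - M + g%:R * (2 * M / N%:R) <= z
    <= - M + g%:R * (2 * M / N%:R) + 2 * M / N%:R.
Proof.
move=> M0 N0 /andP[z1 z2]; set e := 2 * M / N%:R.
have e0 : 0 < e by rewrite divr_gt0 ?ltr0n//; lra.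
have zM0 : 0 <= (z + M) / e by apply: divr_ge0; [lra|exact: ltW].
have /andP[g1 g2] := truncn_itv zM0.
have gN : (Num.truncn ((z + M) / e) < N)%N.
  rewrite -(ltr_nat R); apply: le_lt_trans g1 _.
  rewrite ltr_pdivrMr// /e mulrCA divff ?mulr1 ?pnatr_eq0 -?lt0n//; lra.
exists (Ordinal gN) => /=; move: (Num.truncn _) g1 g2 {gN} => n.
rewrite ler_pdivlMr// ltr_pdivrMr// -natr1 mulrDl mul1r => g1 g2.
by apply/andP; split; lra.
Qed.

Section recoloring.
Variables (R : realType) (d t k : nat).
Local Notation T := (pt R d.+1).
Local Notation mu := (@leb_outer R d.+1).
Local Notation P := (d.+1 * t.+2)%N.
Local Notation K := (P.*2.+1).

(** Positions may repeat, so padded splittings are included, and the strict upper bound [M] suits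
    the half-open grid of [exists_grid_index]. The same [rho] serves all splittings, which makes the
    property stable under small changes of [c]. *)
Definition robust (M : R) (q : T) (r : R) (rho : R) (c : T -> 'I_k.+1) : Prop :=
  forall (y : 'I_d.+1 -> nat -> R) (F : {set {ffun 'I_d.+1 -> 'I_t.+1}}),
    (forall i (l : 'I_t.+2), - M <= y i l < M) ->
    (forall i (l : nat), (l <= t)%N -> y i l <= y i l.+1) ->
    (forall i, y i 0%N <= q i) -> (forall i, q i + r <= y i t.+1) ->
    exists j : 'I_k.+1, rho <= `|imbalance (c @^-1` [set j]) y F|.

(** The left side has one factor [N] fewer than the right, so [N] need only exceed the constant
    [A * 2 ^ K * C ^ (P + 1)]. *)
Lemma exists_grid_size (A C : nat) :
  exists2 N, (0 < N)%N & (N ^ P * A * 2 ^ K * C ^ P.+1 < N ^ P.+1)%N.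
Proof.
exists (A * 2 ^ K * C ^ P.+1).+1 => //.
set X := (A * 2 ^ K * C ^ P.+1)%N.
rewrite (_ : _ * A * _ * _ = X.+1 ^ P * X)%N; last by rewrite /X !mulnA.
by rewrite expnSr ltn_pmul2l ?expn_gt0.
Qed.

Section holders.
Variables (q : T) (u : R).
Hypothesis u0 : 0 < u.

(** The holders sit along the main diagonal, so their projections to every axis are disjoint. *)
Definition holder_lo (j : 'I_K) : T := fun i => q i + u * j%:R.
Definition holder_hi (j : 'I_K) : T := fun i => q i + u * j%:R + u / 2.
Definition holder (j : 'I_K) : set T := box (holder_lo j) (holder_hi j).
(** Only axis 0 is shortened, which makes the volume linear in [s]. *)
Definition subholder (s : R) (j : 'I_K) : set T :=
  box (holder_lo j) (set_coord (holder_hi j) ord0 (holder_lo j ord0 + u / 2 * s)).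

Lemma half_ge0 : 0 <= u / 2.
Proof. exact: divr_ge0 (ltW u0) _. Qed.

Lemma holder_lohi j i : holder_lo j i <= holder_hi j i.
Proof. by rewrite lerDl half_ge0. Qed.

Lemma subholder_lohi s j i : 0 <= s ->
  holder_lo j i <= set_coord (holder_hi j) ord0 (holder_lo j ord0 + u / 2 * s) i.
Proof.
move=> s0; rewrite /set_coord; case: eqP => [->|_]; last exact: holder_lohi.
by rewrite lerDl mulr_ge0 ?half_ge0.
Qed.

Lemma sub_holder s j : s <= 1 -> subholder s j `<=` holder j.
Proof.
move=> s1 x xs i; have := xs i; rewrite /set_coord; case: eqP => [->|//] /andP[-> x2] /=.
by apply: le_trans x2 _; rewrite lerD2l ler_piMr ?half_ge0.
Qed.

Lemma vol_holder j : box_vol (holder_lo j) (holder_hi j) = (u / 2) ^+ d.+1.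
Proof.
rewrite /box_vol (eq_bigr (fun=> u / 2)) ?prodr_const ?card_ord// => i _.
by rewrite /holder_hi /holder_lo; ring.
Qed.

Lemma vol_subholder s j : 0 <= s -> vol (subholder s j) = s * (u / 2) ^+ d.+1.
Proof.
move=> s0; rewrite vol_box; last by move=> i; exact: subholder_lohi.
rewrite box_vol_set_coordr (eq_bigr (fun=> u / 2)); last first.
  by move=> i _; rewrite /holder_hi /holder_lo; ring.
rewrite prodr_const (_ : #|_| = d); last by have := cardC1 (@ord0 d); rewrite card_ord.
by rewrite exprS; ring.
Qed.

Lemma holder_disj i j x : holder i x -> holder j x -> i = j.
Proof. by move=> /(_ ord0) xi /(_ ord0) xj; apply: val_inj; exact: slot_inj u0 xi xj. Qed.

Definition hits (y : 'I_d.+1 -> nat -> R) (p : 'I_d.+1 * 'I_t.+2) (j : 'I_K) :=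
  holder_lo j p.1 <= y p.1 p.2 <= holder_hi j p.1.

(** Sending a hit holder to some hyperplane that hits it is injective, by [slot_inj]. *)
Lemma card_hit (y : 'I_d.+1 -> nat -> R) :
  (#|[set j | [exists p, hits y p j]]%SET| <= P)%N.
Proof.
have p0 : 'I_d.+1 * 'I_t.+2 := (ord0, ord0).
pose g j := odflt p0 [pick p | hits y p j].
have gP j : [exists p, hits y p j] -> hits y (g j) j.
  by rewrite /g => /existsP[p pj]; case: pickP => [//|/(_ p)]; rewrite pj.
have ginj : {in [set j | [exists p, hits y p j]]%SET &, injective g}.
  move=> i j; rewrite !inE => /gP gi /gP gj gij; rewrite gij in gi.
  by apply: val_inj; exact: slot_inj u0 gi gj.
rewrite -(card_in_imset ginj) (leq_trans (max_card _))//.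
by rewrite card_prod !card_ord.
Qed.

End holders.

Lemma cell_union_addbox (M : R) (A B : set T) (y : 'I_d.+1 -> nat -> R) (F : {set {ffun 'I_d.+1 -> 'I_t.+1}})
    (m : {ffun 'I_d.+1 -> 'I_t.+1}) :
  0 <= M -> (forall i (l : 'I_t.+2), - M <= y i l <= M) ->
  leb_measurable B -> A `&` B = set0 ->
  (m \in F -> B `<=` cell_union y F) ->
  (m \notin F -> B `&` cell_union y F = set0) ->
  vol ((A `|` B) `&` cell_union y F) =
  vol (A `&` cell_union y F) + (if m \in F then vol B else 0).
Proof.
move=> M0 yM mB AB0 mF mNF; rewrite setIUl; case: ifPn => [/mF BU|/mNF ->].
  have BE : B `&` cell_union y F = B by apply/setIidPl.
  rewrite BE (volU M0)//; first exact: bounded_by_cell_union.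
  - by rewrite -BE; exact: bounded_by_cell_union.
  - by rewrite setIAC AB0 set0I.
by rewrite setU0 addr0.
Qed.

(** Both [|p + v|] and [|p - v|] are at least [| |p| - v |], which differs from its value at [p'] by
    at most [b]. One condition thus covers both sides of the splitting on which the painted box may
    lie. *)
Lemma norm_gap (p p' v b s : R) : 0 <= v -> `|p - p'| <= b ->
  b + s <= `| `|p'| - v| -> s <= `|p + v| /\ s <= `|p - v|.
Proof.
move=> v0; rewrite ler_norml => /andP[h1 h2].
case: (ger0P p') => hp'; case: ger0P => h3 h4.
all: split; case: ger0P => h5; lra.
Qed.

Lemma exists_notin_setU (I : finType) (A B : {set I}) :
  (#|A| + #|B| < #|I|)%N -> exists2 j, j \notin A & j \notin B.
Proof.
move=> lt; have [j|all] := pickP [pred j | (j \notin A) && (j \notin B)].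
  by move=> /andP[]; exists j.
have : [set: I]%SET \subset A :|: B.
  apply/fintype.subsetP => j _; rewrite finset.in_setU.
  by have /negbT := all j; rewrite /= negb_and !negbK.
by move=> /subset_leq_card; rewrite cardsT cardsU => h; move: lt; lia.
Qed.

Lemma exists_holder_size (r tau : R) : 0 < r -> 0 < tau ->
  exists u : R, [/\ 0 < u, K%:R * u <= r & K%:R * (u / 2) ^+ d.+1 <= tau].
Proof.
move=> r0 tau0; pose m := Order.min r tau.
have m0 : 0 < m by rewrite /m lt_min r0.
have K0 : 0 < K%:R :> R by rewrite ltr0n.
pose u := Order.min 1 (m / K%:R).
have u0 : 0 < u by rewrite /u lt_min ltr01 divr_gt0.
have uK : K%:R * u <= m.
  by rewrite -ler_pdivlMl// mulrC /u ge_min lexx orbT.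
have u1 : u <= 1 by rewrite /u ge_min lexx.
exists u; split => //; first by rewrite (le_trans uK)// /m ge_min lexx.
have mtau : m <= tau by rewrite /m ge_min lexx orbT.
apply: le_trans (le_trans uK mtau); apply: ler_wpM2l; first exact: ltW.
have h0 : 0 <= u / 2 by exact: half_ge0.
(* As [u <= 1], the power is at most its base [u / 2]. *)
rewrite exprS; apply: (@le_trans _ _ (u / 2)); last by lra.
by rewrite ler_piMr// exprn_ile1//; lra.
Qed.

Lemma exists_robust_recoloring (c : T -> 'I_k.+1) (q : T) (r M tau : R) : (K <= k)%N ->
  measurable_coloring c -> 0 < r -> 0 < M -> 0 < tau ->
  exists (c' : T -> 'I_k.+1) (D : set T) (rho : R),
    [/\ measurable_coloring c', leb_measurable D, (mu D <= tau%:E)%E,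
        forall x, ~ D x -> c' x = c x & 0 < rho /\ robust M q r rho c'].
Proof.
move=> Kk mc r0 M0 tau0.
have [u [u0 uKr uKtau]] := exists_holder_size r0 tau0.
pose sg := (u / 2) ^+ d.+1.
have sg0 : 0 < sg by rewrite exprn_gt0// divr_gt0.
(* [L / N] is the bound of [imbalance_close] for a grid of mesh [2 * M / N]. *)
pose L := 2 * P%:R * (2 * M * (2 * M) ^+ d).
have L0 : 0 <= L by rewrite /L !mulr_ge0// ?exprn_ge0// ?mulr_ge0// ltW.
(* The tolerance [L / N + s] and the paint unit [s = sg / N] both scale like [1 / N], so the number
   [C] of forbidden paint levels does not depend on [N] and can be fixed before it. *)
have [C CP] : exists C : nat, 2 * (L + sg) <= C%:R * sg.
  exists (Num.truncn (2 * (L + sg) / sg)).+1.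
  by rewrite -ler_pdivrMr// ltW// truncnS_gt.
have [N N0 NP] := exists_grid_size #|{set {ffun 'I_d.+1 -> 'I_t.+1}}| C.
have NR0 : 0 < N%:R :> R by rewrite ltr0n.
pose s := sg / N%:R; have s0 : 0 < s by rewrite divr_gt0.
pose e := 2 * M / N%:R; have e0 : 0 < e by rewrite divr_gt0// mulr_gt0.
pose V := [set x : T | exists j : 'I_K, holder q u j x].
(* Colour 0 is kept as white; [K <= k] leaves room for the shift. *)
pose col (j : 'I_K) : 'I_k.+1 := inord j.+1.
have colE j : col j = j.+1 :> nat by rewrite inordK// ltnS (leq_trans (ltn_ord j)).
pose A j := c @^-1` [set col j] `&` ~` V.
pose yg (g : {ffun 'I_d.+1 * 'I_t.+2 -> 'I_N}) (i : 'I_d.+1) (l : nat) : R :=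
  - M + (g (i, inord l))%:R * e.
pose X := ({ffun 'I_d.+1 * 'I_t.+2 -> 'I_N} * {set {ffun 'I_d.+1 -> 'I_t.+1}})%type.
(* Paint levels to avoid: those that nearly cancel the old imbalance at the grid point, whatever its
   sign. *)
pose close (x : X) (j : 'I_K) := [set i : 'I_N |
  `| `|imbalance (A j) (yg x.1) x.2| - i.+1%:R * s| < L / N%:R + s]%SET.
have [w wP] : exists w : {ffun 'I_K -> 'I_N},
    forall x, (#|[set j | w j \in close x j]%SET| <= P)%N.
  apply: (@exists_sparse_hits _ _ _ C).
    move=> x j; apply: card_close_indices => //.
    by rewrite -mulrDl mulrA (mulrA _ sg) ler_pM2r// invr_gt0.
  by rewrite card_prod card_ffun card_prod !card_ord.
pose sj j : R := (w j).+1%:R / N%:R.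
have sj0 j : 0 <= sj j by rewrite divr_ge0.
have sj1 j : sj j <= 1 by rewrite ler_pdivrMr// mul1r ler_nat.
have [|||||||c' [mc' c'out c'col]] := @recolor R d k.+1 _ c col ord0
  (holder q u) (fun j => subholder q u (sj j) j).
- exact: mc.
- by move=> j; exact: leb_measurable_box.
- by move=> j; exact: leb_measurable_box.
- by move=> j; exact: sub_holder.
- exact: holder_disj.
- by move=> i j /(congr1 val) /=; rewrite !colE => -[/val_inj].
- by move=> j; rewrite -val_eqE /= colE.
exists c', V, s; split => //.
- by apply: leb_measurable_fin_bigcup => j; exact: leb_measurable_box.
- apply: le_trans (leb_outer_fin_bigcup _) _.
  apply: (@le_trans _ _ (\sum_(j : 'I_K) sg%:E)%E).
    apply: lee_sum => j _; apply: le_trans (leb_outer_box_le _) _.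
      by move=> i; exact: holder_lohi.
    by rewrite vol_holder.
  by rewrite sumEFin sumr_const card_ord -mulr_natl lee_fin.
split => // y F yM ymono yq qy.
have yM' i (l : 'I_t.+2) : - M <= y i l <= M.
  by have /andP[-> /ltW ->] := yM i l.
have [g gP] : exists g : {ffun 'I_d.+1 * 'I_t.+2 -> 'I_N},
    forall i (l : 'I_t.+2), yg g i l <= y i l <= yg g i l + e.
  have : forall p : 'I_d.+1 * 'I_t.+2, exists g : 'I_N,
      - M + g%:R * e <= y p.1 p.2 <= - M + g%:R * e + e.
    by move=> p; exact: exists_grid_index.
  move=> /choice[g gP]; exists (finfun g) => i l.
  by rewrite /yg ffunE inord_val; exact: (gP (i, l)).
have ygM i (l : 'I_t.+2) : - M <= yg g i l <= M.
  rewrite /yg lerDl mulr_ge0//= ?(ltW e0)//.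
  have : (g (i, inord l))%:R * e <= N%:R * e.
    by rewrite ler_pM2r// ler_nat ltnW.
  rewrite /e (mulrC N%:R) divfK ?gt_eqF//; lra.
(* At most [P] holders are hit and at most [P] have a forbidden level; one of the [2 P + 1] escapes
   both. *)
have [j jhit jclose] : exists2 j, j \notin [set j | [exists p, hits q u y p j]]%SET &
    j \notin [set j | w j \in close (g, F) j]%SET.
  apply: exists_notin_setU.
  rewrite card_ord (leq_ltn_trans (leq_add (card_hit q u0 y) (wP (g, F))))//.
  by rewrite addnn.
have unhit i (l : 'I_t.+2) : ~~ (holder_lo q u j i <= y i l <= holder_hi q u j i).
  by move: jhit; rewrite inE negb_exists => /forallP/(_ (i, l)).
have jr : u * j%:R + u / 2 <= r.
  have : u * j.+1%:R <= u * K%:R by rewrite ler_pM2l// ler_nat.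
  by move: uKr; rewrite (mulrC K%:R) -natr1 mulrDr mulr1; lra.
have [m mP] : exists m : {ffun 'I_d.+1 -> 'I_t.+1},
    forall G : {set {ffun 'I_d.+1 -> 'I_t.+1}},
      (m \in G -> holder q u j `<=` cell_union y G) /\
      (m \notin G -> holder q u j `&` cell_union y G = set0).
  apply: box_in_one_cell => // i.
  - exact: holder_lohi.
  - by rewrite (le_trans (yq i))// lerDl mulr_ge0// ltW.
  - by rewrite (le_trans _ (qy i))// /holder_hi -addrA lerD2l.
have volsub : vol (subholder q u (sj j) j) = (w j).+1%:R * s.
  by rewrite vol_subholder// /sj /s -mulrA; congr (_ * _); rewrite mulrC.
have subh : subholder q u (sj j) j `<=` holder q u j by exact: sub_holder.
have imbE G : vol (c' @^-1` [set col j] `&` cell_union y G) =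
    vol (A j `&` cell_union y G) + (if m \in G then (w j).+1%:R * s else 0).
  have [mG mNG] := mP G.
  rewrite c'col -volsub; apply: (cell_union_addbox (M := M)) => //.
  - exact: ltW.
  - exact: leb_measurable_box.
  - apply/seteqP; split => x // -[[_ nV] xs]; apply: nV; exists j; exact: subh.
  - by move=> /mG; apply: subset_trans.
  - by move=> /mNG hU; apply/seteqP; split => x // -[/subh hx Ux]; rewrite -hU.
have Lclose : `|imbalance (A j) y F - imbalance (A j) (yg g) F| <= L / N%:R.
  have := @imbalance_close R d t M e (yg g) y (yg g) F (A j) (ltW M0) (ltW e0) yM' ygM gP.
  rewrite (_ : _ * (e * _) = L / N%:R); last by rewrite /L /e; ring.
  by apply=> i l; rewrite lexx lerDl ltW.
have [||gap1 gap2] := norm_gap (v := (w j).+1%:R * s) (s := s) _ Lclose.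
- by rewrite mulr_ge0// ltW.
- by move: jclose; rewrite !inE -leNgt.
exists (col j); move: gap1 gap2; rewrite /imbalance !imbE finset.in_setC; case: (m \in F) => /= gap1 gap2.
- by apply: le_trans gap1 _; rewrite addr0 addrAC.
- by apply: le_trans gap2 _; rewrite addr0 opprD addrA.
Qed.

End recoloring.

(** * The limit colouring *)

(** The small cubes have corners in the lattice of mesh [1 / (m + 1)] and that same side, with
    [M = m + 1]; integer vectors and [m] are enumerated by [unpickle]. *)
Lemma exists_stages (R : realType) (d : nat) :
  exists (q : nat -> pt R d) (r M : nat -> R),
    [/\ forall n, 0 < r n, forall n, 0 < M n &
        forall (a : pt R d) (s : R), 0 < s -> exists n, forall i,
          [/\ a i <= q n i, q n i + r n <= a i + s, - M n <= a i & a i + s < M n]].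
Proof.
pose ix n : {ffun 'I_d -> int} * nat := odflt ([ffun=> 0], 0%N) (unpickle n).
exists (fun n i => ((ix n).1 i)%:~R / (ix n).2.+1%:R), (fun n => (ix n).2.+1%:R^-1),
  (fun n => (ix n).2.+1%:R); split => // a s s0.
(* The term [2 / s] makes two mesh steps fit in [s], one for rounding [a] up to the lattice and one
   for the small cube; the sum dominates every [|a i| + s]. *)
pose B := 2 / s + \sum_(i < d) (`|a i| + s).
pose m := Num.truncn B.
have Bm : B < m.+1%:R by rewrite truncnS_gt.
have m0 : 0 < m.+1%:R :> R by [].
have sum0 : 0 <= \sum_(i < d) (`|a i| + s).
  by apply: sumr_ge0 => i _; rewrite addr_ge0// ltW.
have ms : 2 / m.+1%:R <= s.
  rewrite ler_pdivrMr// mulrC -ler_pdivrMr// ltW//; apply: le_lt_trans Bm.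
  by rewrite /B lerDl.
have ma i : `|a i| + s < m.+1%:R.
  apply: le_lt_trans Bm; apply: (@le_trans _ _ (\sum_(j < d) (`|a j| + s))).
    by rewrite (bigD1 i)//= lerDl sumr_ge0// => j _; rewrite addr_ge0// ltW.
  by rewrite /B lerDr divr_ge0// ltW.
pose g : {ffun 'I_d -> int} := [ffun i => Num.ceil (a i * m.+1%:R)].
exists (pickle (g, m)) => i; rewrite /ix pickleK /= ffunE.
have := ceil_itv (a i * m.+1%:R); set z := Num.ceil _ => /andP[z1 z2].
split.
- by rewrite ler_pdivlMr.
- apply: (@le_trans _ _ (a i + 2 / m.+1%:R)); last by rewrite lerD2l.
  rewrite -[X in _ + X]div1r -mulrDl ler_pdivrMr// mulrDl divfK ?gt_eqF//.
  by move: z1; rewrite intrB; lra.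
- have := ma i; have := lerNnormlW (lexx `|a i|); lra.
- by apply: le_lt_trans (ma i); rewrite lerD2r ler_norm.
Qed.

Section construction.
Variables (R : realType) (d t k : nat).
Local Notation T := (pt R d.+1).
Local Notation mu := (@leb_outer R d.+1).
Local Notation P := (d.+1 * t.+2)%N.
Local Notation K := (P.*2.+1).

Lemma imbalance_perturb (M e : R) (y : 'I_d.+1 -> nat -> R)
    (F : {set {ffun 'I_d.+1 -> 'I_t.+1}}) (A B E : set T) :
  0 <= M -> (forall i (l : 'I_t.+2), - M <= y i l <= M) ->
  (forall x, ~ E x -> (A x <-> B x)) -> (mu E <= e%:E)%E ->
  `|imbalance A y F - imbalance B y F| <= 2 * e.
Proof.
move=> M0 yM AB Ee.
have half (G : {set {ffun 'I_d.+1 -> 'I_t.+1}}) (A' B' : set T) :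
    (forall x, ~ E x -> (A' x <-> B' x)) ->
    vol (A' `&` cell_union y G) <= vol (B' `&` cell_union y G) + e.
  move=> AB'; rewrite -[e]mul1r -[1]/(1%:R) -card_unit.
  apply: (vol_le_bigcup (S := fun=> E) M0) => //; try exact: bounded_by_cell_union.
  move=> x [Ax Ux]; have [Ex|nEx] := pselect (E x); first by right; exists tt.
  by left; split => //; apply/(AB' x nEx).
have BA x : ~ E x -> (B x <-> A x) by move=> /AB AxB; split => /AxB.
have := half F A B AB; have := half F B A BA.
have := half (~: F) A B AB; have := half (~: F) B A BA.
by rewrite /imbalance ler_norml; lra.
Qed.

(** The budget [tau (n + 1)] is set once [rho n] is known. Halving bounds all changes from stage
    [n + 1] on by [2 * tau (n + 1) <= rho n / 4], hence the change of any imbalance by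
    [rho n / 2]. *)
Lemma exists_step_sequence (q : nat -> T) (r M : nat -> R) : (K <= k)%N ->
  (forall n, 0 < r n) -> (forall n, 0 < M n) ->
  exists (c : nat -> T -> 'I_k.+1) (D : nat -> set T) (tau rho : nat -> R),
    forall n,
      [/\ measurable_coloring (c n), leb_measurable (D n), (mu (D n) <= (tau n)%:E)%E,
          forall x, ~ D n x -> c n.+1 x = c n x &
          [/\ 0 < tau n, tau n.+1 <= tau n / 2, tau n.+1 <= rho n / 8, 0 < rho n &
              robust t (M n) (q n) (r n) (rho n) (c n.+1)]].
Proof.
move=> Kk r0 M0.
pose good (p : nat * (T -> 'I_k.+1) * R) (v : (T -> 'I_k.+1) * set T * R) :=
  measurable_coloring p.1.2 -> 0 < p.2 ->
  [/\ measurable_coloring v.1.1, leb_measurable v.1.2, (mu v.1.2 <= p.2%:E)%E,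
      forall x, ~ v.1.2 x -> v.1.1 x = p.1.2 x &
      0 < v.2 /\ robust t (M p.1.1) (q p.1.1) (r p.1.1) v.2 v.1.1].
have [f fP] : {f & forall p, good p (f p)}.
  apply: choice => -[[n c] tau].
  have [[mc tau0]|nh] := pselect (measurable_coloring c /\ 0 < tau).
    have [c' [D [rho H]]] := exists_robust_recoloring (q n) Kk mc (r0 n) (M0 n) tau0.
    by exists (c', D, rho).
  (* A dummy value makes [f] total; [stP] shows that the recursion stays among valid inputs. *)
  by exists (c, set0, 0) => mc tau0; case: nh.
pose next n (st : (T -> 'I_k.+1) * R) :=
  let v := f (n, st.1, st.2) in (v.1.1, Order.min (st.2 / 2) (v.2 / 8)).
pose st := fix st n := if n is n'.+1 then next n' (st n') else (fun=> ord0, 1 : R).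
pose v n := f (n, (st n).1, (st n).2).
have stP n : measurable_coloring (st n).1 /\ 0 < (st n).2.
  elim: n => [|n [mc tau0]] /=.
    split => //; move=> j; have [->|/eqP nj] := eqVneq j ord0.
      rewrite (_ : _ @^-1` _ = ~` set0); first exact/leb_measurableC/leb_measurable0.
      by rewrite setC0; apply/seteqP; split.
    rewrite (_ : _ @^-1` _ = set0); first exact: leb_measurable0.
    by apply/seteqP; split => // x /= /esym.
  have [mc' _ _ _ [rho0 _]] := fP (n, (st n).1, (st n).2) mc tau0.
  by split => //; rewrite lt_min !divr_gt0.
exists (fun n => (st n).1), (fun n => (v n).1.2), (fun n => (st n).2), (fun n => (v n).2) => n.
have [mc tau0] := stP n.
have [mc' mD Dtau out [rho0 rob]] := fP (n, (st n).1, (st n).2) mc tau0.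
by split => //; split => //=; rewrite ge_min lexx ?orbT.
Qed.

(** Outside [E n], the union of all [D m] with [m >= n], the colour is frozen from stage [n] on, and
    the geometric decay of [tau] bounds the measure of [E n] by [2 * tau n]. *)
Lemma exists_limit_coloring (c : nat -> T -> 'I_k.+1) (D : nat -> set T) (tau : nat -> R) :
  (forall n, measurable_coloring (c n)) -> (forall n, leb_measurable (D n)) ->
  (forall n, (mu (D n) <= (tau n)%:E)%E) ->
  (forall n x, ~ D n x -> c n.+1 x = c n x) ->
  (forall n, 0 < tau n) -> (forall n, tau n.+1 <= tau n / 2) ->
  exists2 cl : T -> 'I_k.+1, measurable_coloring cl &
    forall n, exists2 E : set T, (mu E <= (2 * tau n)%:E)%E &
      forall x, ~ E x -> cl x = c n x.
Proof.
move=> mc mD Dtau cD tau0 tauh.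
pose E n := \bigcup_m D (n + m)%N.
have mE n : leb_measurable (E n) by apply: leb_measurable_bigcup => m.
have notE n x m : ~ E n x -> (n <= m)%N -> c m x = c n x.
  move=> nE; elim: m => [|m IH]; first by rewrite leqn0 => /eqP ->.
  rewrite leq_eqVlt => /orP[/eqP ->//|nm]; rewrite cD ?IH// => Dm; apply: nE.
  by exists (m - n)%N => //; rewrite subnKC.
(* Points in every [E n], whose colour may never settle, receive colour 0. *)
pose cl x := if pselect (exists n, ~ E n x) is left ex
  then c (projT1 (cid ex)) x else ord0.
have clE n x : ~ E n x -> cl x = c n x.
  rewrite /cl => nE; case: pselect => [ex|[]]; last by exists n.
  case: cid => /= n0 nE0; have [/(notE _ _ _ nE0) ->//|/ltnW/(notE _ _ _ nE)//] := leqP n0 n.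
have cl0 x : ~ (exists n, ~ E n x) -> cl x = ord0.
  by rewrite /cl; case: pselect.
exists cl => [j|n].
  pose N := [set x | exists n, ~ E n x].
  have mN : leb_measurable N.
    rewrite (_ : N = \bigcup_n ~` E n); last first.
      by apply/seteqP; split => x [n]; exists n.
    by apply: leb_measurable_bigcup => n; exact: leb_measurableC.
  rewrite (_ : _ @^-1` _ = (\bigcup_n (c n @^-1` [set j] `&` ~` E n)) `|`
      (if j == ord0 then ~` N else set0)); last first.
    apply/seteqP; split => x /=.
      have [[n nE]|nN] := pselect (exists n, ~ E n x).
        by rewrite (clE n)// => cj; left; exists n.
      by rewrite cl0// => <-; right; rewrite eqxx.
    case=> [[n _ [cj nE]]|]; first by rewrite (clE n).
    by case: eqP => // -> nN; exact: cl0.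
  apply: leb_measurableU; last first.
    by case: eqP => _; [exact: leb_measurableC|exact: leb_measurable0].
  apply: leb_measurable_bigcup => n; apply: leb_measurableI; first exact: mc.
  exact: leb_measurableC.
exists (E n) => [|x]; last exact: clE.
have taun m : tau (n + m)%N <= tau n / 2 ^+ m.
  elim: m => [|m IH]; first by rewrite addn0 expr0 divr1.
  rewrite addnS; apply: le_trans (tauh _) _.
  by rewrite exprSr invfM mulrA; apply: ler_wpM2r => //; rewrite invr_ge0.
apply: le_trans (outer_measure_sigma_subadditive mu _) _.
apply: le_trans (epsilon_trick0 xpredT _); last by rewrite mulr_ge0// ltW.
apply: lee_nneseries => [m _ _|m _]; first exact: leb_outer_ge0.
apply: le_trans (Dtau _) _; rewrite lee_fin (le_trans (taun m))//.
by rewrite natrX exprS invfM mulrA (mulrC 2) mulfK.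
Qed.

End construction.

(** * Cuboids of a splitting *)

Section padded_breakpoints.
Variables (R : realType) (d t : nat) (a : pt R d) (s : R) (H : 'I_d -> seq R).
Hypotheses (s0 : 0 < s) (splitH : is_splitting a s H).
Hypothesis (sizeH : (splitting_size H <= t)%N).

(** The default value repeats the upper face, so that position [t + 1] is [a i + s] however short
    [H i] is. *)
Definition padded (i : 'I_d) (l : nat) : R :=
  nth (a i + s) (breakpoints a s H i) l.

Lemma size_breakpoints i : size (breakpoints a s H i) = (size (H i)).+2.
Proof. by rewrite /breakpoints /= size_rcons size_sort. Qed.

Lemma sizeH_le i : (size (H i) <= t)%N.
Proof. by apply: leq_trans sizeH; exact: (leq_bigmax i). Qed.

Lemma padded_default i l : (size (H i) < l)%N -> padded i l = a i + s.
Proof.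
move=> lt; rewrite /padded /breakpoints; case: l lt => // l.
rewrite ltnS => lt /=; rewrite nth_rcons size_sort ltnNge lt /=.
by case: ifP.
Qed.

Lemma mem_breakpoints i z : z \in breakpoints a s H i -> a i <= z <= a i + s.
Proof.
rewrite inE mem_rcons inE mem_sort => /orP[/eqP ->|/orP[/eqP ->|zH]].
- by rewrite lexx lerDl ltW.
- by rewrite lexx lerDl ltW.
- by have [_ /(_ _ zH)/andP[/ltW -> /ltW ->]] := splitH i.
Qed.

Lemma padded_bound i l : a i <= padded i l <= a i + s.
Proof.
have [lt|ge] := ltnP l (size (breakpoints a s H i)).
  by apply: mem_breakpoints; exact: mem_nth.
by rewrite /padded nth_default// lexx lerDl ltW.
Qed.

Lemma padded_mono i l : padded i l <= padded i l.+1.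
Proof.
have [lt|ge] := ltnP l.+1 (size (breakpoints a s H i)); last first.
  by rewrite {2}/padded nth_default//; have /andP[] := padded_bound i l.
suff : sorted <=%R (breakpoints a s H i).
  by move=> /(sortedP (a i + s))/(_ l lt).
rewrite /breakpoints /= rcons_path; apply/andP; split.
  rewrite path_sortedE; last exact: le_trans.
  apply/andP; split; last exact: sort_le_sorted.
  apply/allP => z; rewrite mem_sort => zH.
  by have [_ /(_ _ zH)/andP[/ltW]] := splitH i.
have : last (a i) (sort <=%R (H i)) \in a i :: sort <=%R (H i) by exact: mem_last.
rewrite inE mem_sort => /orP[/eqP ->|zH]; first by rewrite lerDl ltW.
by have [_ /(_ _ zH)/andP[_ /ltW]] := splitH i.
Qed.

(** A padding cell follows the last cuboid of its row, so the translation commutes with complements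
    and treats [F] and its complement alike. *)
Definition clip_family (F : set ('I_d -> nat)) : {set {ffun 'I_d -> 'I_t.+1}} :=
  [set m : {ffun 'I_d -> 'I_t.+1} | `[< F (fun i => minn (m i) (size (H i))) >]]%SET.

Lemma clip_familyC F : ~: clip_family F = clip_family (~` F).
Proof. by apply/setP => m; rewrite !inE asbool_neg. Qed.

(* The cells added by the padding are faces of the last cuboid of the row. *)
Lemma cell_union_padded F :
  cell_union padded (clip_family F) = cuboid_union a s H F.
Proof.
have nthE i l : (l <= (size (H i)).+1)%N -> nth 0 (breakpoints a s H i) l = padded i l.
  by move=> lt; apply: set_nth_default; rewrite size_breakpoints.
apply/seteqP; split => x /=.
  move=> [m]; rewrite inE => /asboolP Fm xm.
  exists (fun i => minn (m i) (size (H i))); split => // [i|i]; first exact: geq_minr.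
  have mi : (minn (m i) (size (H i)) <= size (H i))%N by exact: geq_minr.
  rewrite !nthE ?ltnS ?(leqW mi)//.
  have [le|gt] := leqP (m i) (size (H i)); first exact: xm.
  have := xm i; rewrite (padded_default gt) (padded_default (leqW gt)).
  rewrite (padded_default (ltnSn (size (H i)))).
  move=> /andP[x1 ->]; rewrite andbT (le_trans _ x1)//.
  by have /andP[] := padded_bound i (size (H i)).
move=> [m [mH Fm xm]]; exists [ffun i => inord (m i)].
  rewrite inE; apply/asboolP.
  rewrite (_ : (fun i => _) = m)//; apply: funext => i.
  rewrite ffunE inordK ?ltnS ?(leq_trans (mH i) (sizeH_le i))//.
  exact/minn_idPl/mH.
move=> i; rewrite ffunE inordK ?ltnS ?(leq_trans (mH i) (sizeH_le i))//.
by have := xm i; rewrite !nthE// ?ltnS ?leqW.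
Qed.

End padded_breakpoints.

(** * Number of colours and conclusion *)

(** The left side is [2 P + 2]: one colour per holder, plus white. The differences of powers are at
    least [2 d + 1] and [(d + 1) t], and with these lower bounds the right side equals the left. *)
Lemma colors_bound (t d : nat) :
  ((d.+1 * t.+2).*2.+2 <=
   (t + 4) ^ d.+1 - (t + 3) ^ d.+1 + (t + 2) ^ d.+1 - 2 ^ d.+1 + d.+1 * (t + 2) + 3)%N.
Proof.
have h1 : ((t + 3) ^ d.+1 + d.*2.+1 <= (t + 4) ^ d.+1)%N.
  elim: d => [|d IH]; first by rewrite !expn1; lia.
  rewrite [((t + 3) ^ _.+2)%N]expnS [((t + 4) ^ _.+2)%N]expnS; nia.
have h2 : (2 ^ d.+1 + d.+1 * t <= (t + 2) ^ d.+1)%N.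
  elim: d {h1} => [|d IH]; first by rewrite !expn1; lia.
  rewrite [(2 ^ _.+2)%N]expnS [((t + 2) ^ _.+2)%N]expnS.
  have : (0 < 2 ^ d.+1)%N by rewrite expn_gt0.
  nia.
lia.
Qed.

Theorem theorem3 (R : realType) (t d k : nat) :
  (1 <= t)%N -> (1 <= d)%N ->
  ((t + 4) ^ d - (t + 3) ^ d + (t + 2) ^ d - 2 ^ d + d * (t + 2) + 3 <= k)%N ->
  exists c : pt R d -> 'I_k,
    measurable_coloring c /\
    forall (a : pt R d) (s : R) (H : 'I_d -> seq R),
      0 < s -> is_splitting a s H -> (splitting_size H <= t)%N ->
      ~ fair_splitting c a s H.
Proof.
move=> _; case: d => // d _ /(leq_trans (colors_bound t d)).
case: k => // k; rewrite ltnS => Kk.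
have [q [r [M [r0 M0 stages]]]] := exists_stages R d.+1.
have [c [D [tau [rho seqP]]]] := exists_step_sequence q Kk r0 M0.
have [cl mcl clP] : exists2 cl : pt R d.+1 -> 'I_k.+1, measurable_coloring cl &
    forall n, exists2 E : set (pt R d.+1), (leb_outer E <= (2 * tau n)%:E)%E &
      forall x, ~ E x -> cl x = c n x.
  by apply: (exists_limit_coloring (D := D)) => n; have [? ? ? ? []] := seqP n.
exists cl; split => // a s H s0 splitH sizeH [F fairF].
have [n nP] := stages a s s0.
pose y := padded a s H; pose G := clip_family t H F.
have yM i (l : 'I_t.+2) : - M n <= y i l < M n.
  have [_ _ aM asM] := nP i; have /andP[y1 y2] := padded_bound s0 splitH i l.
  by rewrite (le_trans aM y1) (le_lt_trans y2 asM).
have yM' i (l : 'I_t.+2) : - M n <= y i l <= M n.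
  by have /andP[-> /ltW ->] := yM i l.
have [_ _ _ _ [_ _ tau_rho rho0 rob]] := seqP n.
have [||||j] := rob y G.
- exact: yM.
- by move=> i l _; exact: padded_mono.
- by move=> i; have [] := nP i.
- move=> i; rewrite /y padded_default; last by rewrite ltnS sizeH_le.
  by have [] := nP i.
have [E Etau clE] := clP n.+1.
have := @imbalance_perturb R d t (M n) (2 * tau n.+1) y G
  (c n.+1 @^-1` [set j]) (cl @^-1` [set j]) E (ltW (M0 n)) yM'.
(* Fairness equates the doubled measures of both sides; they are finite, so the equation passes to
   the reals and 2 cancels. *)
have -> : imbalance (cl @^-1` [set j]) y G = 0.
  have [/= fair1 fair2] := fairF j.
  have fin (G' : {set {ffun 'I_d.+1 -> 'I_t.+1}}) :
      leb_outer (cl @^-1` [set j] `&` cell_union y G') \is a fin_num.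
    by apply: (bounded_by_fin_num (ltW (M0 n))); exact: bounded_by_cell_union.
  have := etrans fair1 (esym fair2).
  rewrite -!(cell_union_padded s0 splitH sizeH) -clip_familyC => /(congr1 fine).
  by rewrite !fineM ?fin//= /imbalance /vol -/y -/G; lra.
rewrite subr0 => perturb rho_le.
have : `|imbalance (c n.+1 @^-1` [set j]) y G| <= 2 * (2 * tau n.+1).
  by apply: perturb => // x /clE clx; rewrite /preimage /= clx.
(* Contradiction: [rho n <= 4 * tau (n + 1) <= rho n / 2] with [rho n > 0]. *)
lra.
Qed.
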